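(* Let $X,Y$ be separable Banach spaces and $p,q\in[1,+\infty)$. If there exists a H\''older$(\frac{p}{q})$ embedding from $X$ into $\ell_q(Y)$, then $E(X,p)\le_B E(Y,q)$.
   Context: For a Banach space $Y$ and $q\in[1,\infty)$, $\ell_q(Y)$ is the Banach space of sequences $x\in Y^{\mathbb N}$ with $\|x\|_{Y,q}=(\sum_n\|x(n)\|_Y^q)^{1/q}<\infty$. For a separable Banach space $X$ and $p\in[1,\infty)$, $E(X,p)$ is the equivalence relation on the Polish space $X^{\mathbb N}$ (product topology) given by $(x,y)\in E(X,p)\iff\sum_{n}\|x(n)-y(n)\|_X^p<+\infty$, i.e. $E(X,p)=X^{\mathbb N}/\ell_p(X)$. For equivalence relations $E,F$ on Polish spaces $P,Q$, $E\le_B F$ means there is a Borel map $\theta:P\to Q$ with $(x,y)\in E\iff(\theta(x),\theta(y))\in F$. For metric spaces $(M,d),(M',d')$ and $\alpha>0$, a map $T:M\to M'$ is a H\''older$(\alpha)$ embedding if there is $A>0$ with $\frac1A d(u,v)^\alpha\le d'(T(u),T(v))\le A d(u,v)^\alpha$ for all $u,v\in M$. *)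

(* Defs.v *)
From HB Require Import structures.
From mathcomp Require Import all_boot all_order all_algebra.
From mathcomp Require Import all_classical all_reals all_analysis.

Set Implicit Arguments.
Unset Strict Implicit.
Unset Printing Implicit Defensive.

Import Order.TTheory GRing.Theory Num.Theory.
Import numFieldNormedType.Exports.

Local Open Scope classical_set_scope.
Local Open Scope ring_scope.

Definition separable_space (T : topologicalType) : Prop :=
  exists2 D : set T, countable D & dense D.

Section sequence_spaces.
Context {R : realType} {Y : normedModType R}.

Definition power_sum (q : R) (x : nat -> Y) : \bar R :=
  (\sum_(0 <= n <oo) (`|x n| `^ q)%:E)%E.

Definition power_summable (q : R) (x : nat -> Y) : Prop :=
  (power_sum q x < +oo)%E.

Definition lq_norm (q : R) (x : nat -> Y) : R :=
  fine (power_sum q x) `^ q^-1.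

(* For power-summable arguments the value +oo, which fine would send to 0,
   does not occur in lq_norm q (x - y). *)
Lemma power_summableB (q : R) (x y : nat -> Y) : 1 <= q ->
  power_summable q x -> power_summable q y ->
  power_summable q (fun n => x n - y n).
Proof.
move=> q1 sx sy; have q0 : 0 <= q by rewrite (le_trans _ q1).
have pos (z : nat -> Y) n : (0 <= (`|z n| `^ q)%:E)%E.
  by rewrite lee_fin powR_ge0.
rewrite /power_summable; apply: (@le_lt_trans _ _
  ((2 `^ q)%:E * (power_sum q x + power_sum q y))%E); last first.
  by rewrite lte_mul_pinfty ?lee_fin ?powR_ge0// lte_add_pinfty.
rewrite -nneseriesD//.
rewrite -nneseriesZl//; last by move=> n _; rewrite adde_ge0.
apply: lee_nneseries => // n _.
rewrite -EFinD -EFinM lee_fin mulrDr -!powRM//.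
have h : `|x n - y n| <= 2 * Num.max `|x n| `|y n|.
  rewrite (le_trans (ler_normB _ _))// mulr_natl mulr2n.
  by rewrite lerD// le_max lexx ?orbT.
have m0 : 0 <= Num.max `|x n| `|y n| by rewrite le_max normr_ge0.
apply: (@le_trans _ _ ((2 * Num.max `|x n| `|y n|) `^ q)).
  by apply: ge0_ler_powR; rewrite ?nnegrE ?mulr_ge0.
by case: (leP `|x n| `|y n|) => _; rewrite ?lerDl ?lerDr powR_ge0.
Qed.

End sequence_spaces.

Definition lq_space (R : realType) (Y : normedModType R) (q : R) : Type :=
  {x : nat -> Y | power_summable q x}.

Definition lq_dist (R : realType) (Y : normedModType R) (q : R)
    (x y : lq_space Y q) : R :=
  lq_norm q (fun n => sval x n - sval y n).

Definition norm_dist (R : realType) (X : normedModType R) (u v : X) : R :=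
  `|u - v|.

Definition holder_embedding (R : realType) (M M' : Type)
    (d : M -> M -> R) (d' : M' -> M' -> R) (alpha : R) (T : M -> M') : Prop :=
  exists2 A : R, 0 < A & forall u v : M,
    A^-1 * d u v `^ alpha <= d' (T u) (T v) /\
    d' (T u) (T v) <= A * d u v `^ alpha.

Definition E_rel (R : realType) (X : normedModType R) (p : R)
    (x y : {ptws nat -> X}) : Prop :=
  power_summable p (fun n => x n - y n).

Definition borel_map (P Q : topologicalType) (f : P -> Q) : Prop :=
  forall B : set Q, <<s @open Q >> B -> <<s @open P >> (f @^-1` B).

Definition borel_reducible (P Q : topologicalType)
    (E : P -> P -> Prop) (F : Q -> Q -> Prop) : Prop :=
  exists2 theta : P -> Q, borel_map theta &
    forall x y : P, E x y <-> F (theta x) (theta y).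

(* Main.v *)
(* Concatenate the sequences T (x i) along a bijection nat -> nat * nat: the
   q-th power sum of the resulting difference is the sum over i of
   ||T (x i) - T (y i)||_q ^ q, which the Hoelder(p/q) bounds compare with
   ||x i - y i|| ^ p. Every coordinate of T is Hoelder, so this reduction is
   even continuous. *)
Require Import Defs.
From HB Require Import structures.
From mathcomp Require Import all_boot all_order all_algebra.
From mathcomp Require Import all_classical all_reals all_analysis.
Import Order.TTheory GRing.Theory Num.Theory.
Import numFieldNormedType.Exports.
Local Open Scope classical_set_scope.
Local Open Scope ring_scope.

Lemma continuous_borel_map (P Q : topologicalType) (f : P -> Q) :
  continuous f -> borel_map f.
Proof.
move=> /continuousP cf; apply: smallest_sub => [|B oB]; last first.
  exact: sub_sigma_algebra (cf _ oB).
have := @sigma_algebra_image _ _ setT f _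
  (smallest_sigma_algebra setT (@open P)).
by congr sigma_algebra; apply/funext => B; rewrite /image_set_system/= setTI.
Qed.

Lemma continuous_ptws (P Q : topologicalType) (I : choiceType)
    (f : P -> {ptws I -> Q}) :
  (forall i, continuous (fun x => f x i)) -> continuous f.
Proof.
move=> cf x; apply/cvg_sup => i; apply/cvg_image.
  by rewrite eqEsubset; split=> // y _; exists (fun=> y).
move=> A /= /cf; rewrite nbhs_simpl/= => fA.
exists [set g | A (g i)]; first exact: fA.
by rewrite eqEsubset; split=> [y [g] /= + <-//|y Ay]; exists (fun=> y).
Qed.

Section power_sums.
Context {R : realType} {Y : normedModType R}.

Lemma power_sum_ge0 (q : R) (x : nat -> Y) : (0 <= power_sum q x)%E.
Proof. by apply: nneseries_ge0 => n _ _; rewrite lee_fin powR_ge0. Qed.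

Lemma power_sumE (q : R) (x : nat -> Y) : 0 < q -> power_summable q x ->
  power_sum q x = (lq_norm q x `^ q)%:E.
Proof.
move=> q0 sx; rewrite /lq_norm -powRrM mulVf ?gt_eqF//.
rewrite powRr1 ?fine_ge0 ?power_sum_ge0// fineK//.
by rewrite ge0_fin_numE ?power_sum_ge0.
Qed.

Lemma ler_norm_lq_norm (q : R) (x : nat -> Y) (n : nat) : 0 < q ->
  power_summable q x -> `|x n| <= lq_norm q x.
Proof.
move=> q0 sx.
suff : `|x n| `^ q <= lq_norm q x `^ q.
  rewrite leNgt => h; rewrite leNgt; apply: contra h => h.
  by rewrite gt0_ltr_powR// nnegrE ?powR_ge0.
rewrite -lee_fin -power_sumE//.
apply: (@le_trans _ _ (\sum_(0 <= k < n.+1) (`|x k| `^ q)%:E)%E); last first.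
  by apply: nneseries_lim_ge => k _ _; rewrite lee_fin powR_ge0.
rewrite big_nat_recr//= leeDr// sume_ge0//.
Qed.

Lemma power_sum_reindex (q : R) (e : nat -> nat * nat) (z : nat -> nat -> Y) :
  set_bij setT setT e ->
  power_sum q (fun n => z (e n).1 (e n).2) =
  (\sum_(0 <= i <oo) power_sum q (z i))%E.
Proof.
move=> be.
have ge0 i j : (0 <= (`|z i j| `^ q)%:E)%E by rewrite lee_fin powR_ge0.
rewrite /power_sum !nneseries_esumT//; last by move=> i; exact: power_sum_ge0.
under [RHS]eq_esum => i _ do rewrite nneseries_esumT//.
rewrite esum_esum//.
rewrite -(@reindex_esum _ _ _ _ _ e
  (fun k : nat * nat => (`|z k.1 k.2| `^ q)%:E) be).
by congr esum; apply/seteqP; split.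
Qed.

End power_sums.

Lemma holder_continuous (R : realType) (X Y : normedModType R) (f : X -> Y)
    (A a : R) : 0 < A -> 0 < a ->
  (forall u v, `|f u - f v| <= A * `|u - v| `^ a) -> continuous f.
Proof.
move=> A0 a0 hf u; apply/cvgrPdist_lt => e e0.
have eA0 : 0 < e / A by rewrite divr_gt0.
near=> v; apply: le_lt_trans (hf u v) _.
rewrite mulrC -ltr_pdivlMr//.
suff uv : `|u - v| < (e / A) `^ a^-1.
  have := gt0_ltr_powR a0; move=> /(_ _ _ _ _ uv).
  by rewrite -powRrM mulVf ?gt_eqF// powRr1 ?ltW//; apply;
    rewrite nnegrE// powR_ge0.
near: v; apply: cvgr_dist_lt; [exact: cvg_id|exact: powR_gt0].
Unshelve. all: by end_near. Qed.

Lemma summable_scale_le (R : realType) (C : R) (f g : nat -> R) : 0 <= C ->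
  (forall n, 0 <= f n) -> (forall n, f n <= C * g n) -> (forall n, 0 <= g n) ->
  (\sum_(0 <= n <oo) (g n)%:E < +oo)%E -> (\sum_(0 <= n <oo) (f n)%:E < +oo)%E.
Proof.
move=> C0 f0 fg g0 sg.
apply: (@le_lt_trans _ _ (C%:E * \sum_(0 <= n <oo) (g n)%:E)%E); last first.
  by rewrite lte_mul_pinfty// lee_fin.
rewrite -nneseriesZl//; last by move=> n _; rewrite lee_fin.
apply: lee_nneseries => [n _ _|n _]; first by rewrite lee_fin.
by rewrite -EFinM lee_fin.
Qed.

Theorem theorem1p1 (R : realType) (X Y : completeNormedModType R)
    (sepX : separable_space X) (sepY : separable_space Y)
    (p q : R) (p_ge1 : 1 <= p) (q_ge1 : 1 <= q)
    (hT : exists T : X -> lq_space Y q,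
      holder_embedding (@norm_dist R X) (@lq_dist R Y q) (p / q) T) :
  borel_reducible (@E_rel R X p) (@E_rel R Y q).
Proof.
case: hT => T [A A0 hA].
have q0 : 0 < q by rewrite (lt_le_trans _ q_ge1).
have p0 : 0 < p by rewrite (lt_le_trans _ p_ge1).
have sT u v : power_summable q (fun n => sval (T u) n - sval (T v) n).
  by apply: power_summableB => //; exact: svalP.
have /card_set_bijP[e be] : ([set: nat] #= [set: nat * nat])%card.
  by rewrite card_eq_sym; exact: card_nat2.
exists (fun x n => sval (T (x (e n).1)) (e n).2).
  apply: continuous_borel_map; apply: continuous_ptws => n x.
  apply: (@continuous_comp {ptws nat -> X} X Y (@proj nat (fun=> X) (e n).1)
    (fun u => sval (T u) (e n).2)); first exact: proj_continuous.
  apply: (@holder_continuous _ _ _ _ A (p / q)) => //; first exact: divr_gt0.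
  move=> u v; apply: le_trans (hA u v).2.
  exact: (@ler_norm_lq_norm _ _ q (fun k => sval (T u) k - sval (T v) k)).
move=> x y; rewrite /E_rel /power_summable.
rewrite (@power_sum_reindex _ _ _ _
  (fun i j => sval (T (x i)) j - sval (T (y i)) j) be).
under eq_eseriesr => i _ do rewrite power_sumE//.
have pE u : (`|u : X| `^ (p / q)) `^ q = `|u| `^ p.
  by rewrite -powRrM divfK// gt_eqF.
have [A_ge0 q_ge0] : 0 <= A /\ 0 <= q by rewrite !ltW.
split; apply: (@summable_scale_le _ (A `^ q)) => [|n|n|n]; rewrite ?powR_ge0//;
  have [lo hi] := hA (x n) (y n); rewrite -pE -powRM ?powR_ge0//;
  apply: ge0_ler_powR; rewrite ?nnegrE ?mulr_ge0 ?powR_ge0//.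
by rewrite -ler_pdivrMl.
Qed.
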